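(* Let $k\in\mathbb{N}$, $\epsilon>0$, and let $P\subset\mathbb{R}^d$ be a finite point set with $|P|\ge k$. Suppose that $P$ satisfies weak $(2+2\sqrt 2+\epsilon)$-center separation or $(3+2\sqrt 2+\epsilon)$-center proximity (for $k$ clusters). Then the $k$-clustering computed by Ward's method on $P$ is a $2$-approximation for the $k$-means objective, i.e., its cost is at most $2\,\mathrm{opt}_k(P)$.
   Context: For a finite nonempty $Q\subset\mathbb{R}^d$, $\mu(Q)=\frac{1}{|Q|}\sum_{q\in Q}q$ is its centroid and $\Delta(Q)=\sum_{q\in Q}\|q-\mu(Q)\|^2$. For disjoint finite nonempty $A,B$, $D(A,B)=\Delta(A\cup B)-\Delta(A)-\Delta(B)$. The $k$-means cost of a partition of $P$ into clusters is the sum of $\Delta(Q)$ over its clusters, and $\mathrm{opt}_k(P)=\min_{C\subset\mathbb{R}^d,|C|=k}\sum_{p\in P}\min_{c\in C}\|p-c\|^2$. Ward's method starts with the $|P|$ singleton clusters and repeatedly merges two current clusters $A,B$ minimizing $D(A,B)$ (ties broken arbitrarily); its $k$-clustering is the clustering obtained after $|P|-k$ merges. $P$ satisfies weak $\delta$-center separation if there is an optimal $k$-means clustering $O_1,\dots,O_k$ of $P$ with centers $c_i^*=\mu(O_i)$ such that for every $j$ and every $i\neq j$, $\|c_j^*-c_i^*\|\ge\delta\max_{x\in O_j}\|x-c_j^*\|$. $P$ satisfies $\alpha$-center proximity if there is an optimal $k$-means clustering $O_1,\dots,O_k$ with centers $c_1^*,\dots,c_k^*$ (the centroids) such that for all $i\ne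 j$ and all $x\in O_i$, $\|x-c_j^*\|\ge\alpha\|x-c_i^*\|$. *)

(* Defs.v *)
From HB Require Import structures.
From mathcomp Require Import all_boot all_order all_algebra.
From mathcomp Require Import finmap.
From mathcomp Require Import classical_sets reals.

Set Implicit Arguments.
Unset Strict Implicit.
Unset Printing Implicit Defensive.

Import Order.TTheory GRing.Theory Num.Theory.

Local Open Scope fset_scope.
Local Open Scope ring_scope.

Section KMeans.
Variables (R : realType) (d : nat).

Notation point := ('rV[R]_d).
(* A clustering is the unordered set of its clusters. *)
Notation clustering := {fset {fset 'rV[R]_d}}.

(* Euclidean norm; MathComp-Analysis equips 'rV[R]_d with the sup norm. *)
Definition enorm (x : point) : R := Num.sqrt (\sum_(i < d) x 0 i ^+ 2).

Definition centroid (Q : {fset point}) : point :=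
  (#|` Q|%:R)^-1 *: \sum_(q <- Q) q.

Definition Delta (Q : {fset point}) : R :=
  \sum_(q <- Q) enorm (q - centroid Q) ^+ 2.

Definition ward_cost (A B : {fset point}) : R :=
  Delta (A `|` B) - Delta A - Delta B.

Definition kmeans_cost (O : clustering) : R := \sum_(Q <- O) Delta Q.

Definition is_partition (P : {fset point}) (O : clustering) : Prop :=
  [/\ fset0 \notin O, trivIfset O & fcover O = P].

(* The infimum is over a finite set, hence a minimum when C is nonempty. *)
Definition center_cost (P C : {fset point}) : R :=
  \sum_(p <- P) inf [set enorm (p - c) ^+ 2 | c in [set` C]]%classic.

(* The infimum is attained whenever k <= #|` P|. *)
Definition opt (k : nat) (P : {fset point}) : R :=
  inf [set center_cost P C | C in [set C : {fset point} | #|` C| = k]]%classic.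

Definition optimal_clustering (k : nat) (P : {fset point}) (O : clustering)
    : Prop :=
  [/\ is_partition P O, #|` O| = k & kmeans_cost O = opt k P].

(* The default value 0 of the maximum is harmless, as norms are nonnegative. *)
Definition radius (Q : {fset point}) : R :=
  \big[Num.max/0]_(x <- Q) enorm (x - centroid Q).

Definition weak_center_separation (k : nat) (P : {fset point}) (delta : R)
    : Prop :=
  exists2 O : clustering, optimal_clustering k P O &
    forall A B, A \in O -> B \in O -> B != A ->
      delta * radius A <= enorm (centroid A - centroid B).

Definition center_proximity (k : nat) (P : {fset point}) (alpha : R) : Prop :=
  exists2 O : clustering, optimal_clustering k P O &
    forall A B, A \in O -> B \in O -> A != B ->
      forall x, x \in A ->
        alpha * enorm (x - centroid A) <= enorm (x - centroid B).

Definition singletons (P : {fset point}) : clustering :=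
  [fset [fset p] | p in P].

(* A relation, so that every way of breaking ties is allowed. *)
Definition ward_step (W W' : clustering) : Prop :=
  exists A B : {fset point},
    [/\ [/\ A \in W, B \in W & A != B],
        forall A' B', A' \in W -> B' \in W -> A' != B' ->
          ward_cost A B <= ward_cost A' B' &
        W' = (A `|` B) |` (W `\ A `\ B)].

Inductive ward_run (P : {fset point}) : nat -> clustering -> Prop :=
| ward_start : ward_run P 0 (singletons P)
| ward_merge n W W' :
    ward_run P n W -> ward_step W W' -> ward_run P n.+1 W'.

(* The subtraction on nat is meaningful when k <= #|` P|. *)
Definition ward_clustering (k : nat) (P : {fset point}) (W : clustering)
    : Prop :=
  ward_run P (#|` P| - k) W.

End KMeans.

(* Main.v *)
(* Let O be the separated optimal clustering. The excess of a set A is the cost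
   of A with respect to the centers of O minus Delta A; merging two parts lowers
   the total excess by the cost of the merge, and a cheapest merge therefore costs
   at most excess A + excess B for any two clusters A, B inside a common cluster
   of O. While more than k clusters remain, we maintain a set E of |W| - k of them,
   each having in its O-cluster a representative outside E of no larger excess, so
   that every merge costs at most twice the excess of any member of E. A potential
   argument shows that kmeans_cost W + 2 * (total excess of E) never increases; it
   is at most 2 * kmeans_cost O for singletons and E is empty at the end. The
   separation forbids merging clusters from two different O-clusters that both
   still contain another current cluster: by the formula
   |A| |B| / (|A| + |B|) * ||centroid A - centroid B||^2 for the cost of a merge, it
   would be cheaper to merge the smaller one inside its own O-cluster. *)

Require Import Defs.
From mathcomp Require Import all_boot all_order all_algebra.
From mathcomp Require Import finmap reals ring lra.

Set Implicit Arguments.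
Unset Strict Implicit.
Unset Printing Implicit Defensive.

Import Order.TTheory GRing.Theory Num.Theory.

Local Open Scope fset_scope.
Local Open Scope ring_scope.

(** * Euclidean geometry, centroids and the cost of a merge *)

Section EuclideanNorm.
Variables (R : realType) (d : nat).
Implicit Types (x y c : 'rV[R]_d) (A B : {fset 'rV[R]_d}).

Definition dotrv x y : R := \sum_(i < d) x 0 i * y 0 i.

Lemma dotrvC x y : dotrv x y = dotrv y x.
Proof. by apply: eq_bigr => i _; rewrite mulrC. Qed.

Lemma dotrvDl x y z : dotrv (x + y) z = dotrv x z + dotrv y z.
Proof. by rewrite -big_split; apply: eq_bigr => i _; rewrite mxE mulrDl. Qed.

Lemma dotrvZl a x y : dotrv (a *: x) y = a * dotrv x y.
Proof. by rewrite /dotrv mulr_sumr; apply: eq_bigr => i _; rewrite mxE mulrA. Qed.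

Lemma dotrvDr x y z : dotrv x (y + z) = dotrv x y + dotrv x z.
Proof. by rewrite !(dotrvC x) dotrvDl. Qed.

Lemma dotrvZr a x y : dotrv x (a *: y) = a * dotrv x y.
Proof. by rewrite !(dotrvC x) dotrvZl. Qed.

Lemma dotrv_ge0 x : 0 <= dotrv x x.
Proof. by apply: sumr_ge0 => i _; rewrite -expr2 sqr_ge0. Qed.

Lemma enorm_ge0 x : 0 <= enorm x.
Proof. exact: sqrtr_ge0. Qed.

Lemma enorm_sqr x : enorm x ^+ 2 = dotrv x x.
Proof.
rewrite sqr_sqrtr; last by apply: sumr_ge0 => i _; exact: sqr_ge0.
by apply: eq_bigr => i _; rewrite expr2.
Qed.

Lemma enormZ_sqr a x : enorm (a *: x) ^+ 2 = a ^+ 2 * enorm x ^+ 2.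
Proof. by rewrite !enorm_sqr dotrvZl dotrvZr mulrA. Qed.

Lemma enormN x : enorm (- x) = enorm x.
Proof. by congr Num.sqrt; apply: eq_bigr => i _; rewrite mxE sqrrN. Qed.

Lemma enormB x y : enorm (x - y) = enorm (y - x).
Proof. by rewrite -enormN opprB. Qed.

Lemma enorm0_eq0 x : enorm x = 0 -> x = 0.
Proof.
move=> x0; have /eqP : dotrv x x = 0 by rewrite -enorm_sqr x0 expr0n.
rewrite psumr_eq0 => [/allP h|i _]; last by rewrite -expr2 sqr_ge0.
apply/rowP => i; rewrite mxE; apply/eqP.
by have := h i (mem_index_enum _); rewrite mulf_eq0 orbb.
Qed.

(** Cauchy-Schwarz: for nonzero vectors, expand the square of [enorm y *: x - enorm x *: y], which
    is nonnegative, and cancel the positive factor [enorm x * enorm y]. *)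
Lemma dotrv_le_enorm x y : dotrv x y <= enorm x * enorm y.
Proof.
have x0 := enorm_ge0 x; have y0 := enorm_ge0 y.
have [/enorm0_eq0->|xn0] := eqVneq (enorm x) 0.
  by rewrite -(scale0r 0) dotrvZl mul0r mulr_ge0 ?enorm_ge0.
have [/enorm0_eq0->|yn0] := eqVneq (enorm y) 0.
  by rewrite -(scale0r 0) dotrvZr mul0r mulr_ge0 ?enorm_ge0.
have : 0 < enorm x * enorm y by rewrite mulr_gt0 // lt0r ?xn0 ?yn0.
have := dotrv_ge0 (enorm y *: x + (- enorm x) *: y).
rewrite !(dotrvDl, dotrvDr, dotrvZl, dotrvZr) -!enorm_sqr (dotrvC y x).
by nra.
Qed.

Lemma enormD x y : enorm (x + y) <= enorm x + enorm y.
Proof.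
rewrite -(ler_pXn2r (n := 2)) ?nnegrE ?addr_ge0 ?enorm_ge0 //.
rewrite enorm_sqr !(dotrvDl, dotrvDr) (dotrvC y x) -!enorm_sqr.
by have := dotrv_le_enorm x y; nra.
Qed.

Lemma sum_centroid A : \sum_(a <- A) a = #|` A|%:R *: centroid A.
Proof.
have [->|A0] := eqVneq A fset0; first by rewrite big_seq_fset0 cardfs0 scale0r.
by rewrite scalerA divff ?scale1r // pnatr_eq0 cardfs_eq0.
Qed.

Lemma dotrv_suml (I : Type) (s : seq I) (F : I -> 'rV[R]_d) y :
  \sum_(i <- s) dotrv (F i) y = dotrv (\sum_(i <- s) F i) y.
Proof.
apply: (big_ind2 (fun a b => a = dotrv b y)) => // [|a b a' b' -> ->].
  by rewrite -(scale0r 0) dotrvZl mul0r.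
by rewrite dotrvDl.
Qed.

Lemma sum_fset_const (V : lmodType R) A (x : V) :
  \sum_(a <- A) x = #|` A|%:R *: x.
Proof. by rewrite big_const_seq count_predT iter_addr_0 scaler_nat. Qed.

(** Splitting [a - c] at the centroid leaves a cross term that is linear in the deviations from the
    centroid, and these sum to zero. *)
Lemma parallel_axis A c : \sum_(a <- A) enorm (a - c) ^+ 2 =
  Delta A + #|` A|%:R * enorm (centroid A - c) ^+ 2.
Proof.
set m := centroid A; set w := m - c.
have cross0 : \sum_(a <- A) dotrv (a - m) w = 0.
  rewrite dotrv_suml sumrB sum_centroid sum_fset_const -/m subrr.
  by rewrite -(scale0r 0) dotrvZl mul0r.
have -> : \sum_(a <- A) enorm (a - c) ^+ 2 =
    \sum_(a <- A) (enorm (a - m) ^+ 2 + (enorm w ^+ 2 + 2 * dotrv (a - m) w)).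
  apply: eq_bigr => a _; have -> : a - c = (a - m) + w by rewrite addrA subrK.
  rewrite !enorm_sqr; move: (a - m) (w) => u z.
  by rewrite !(dotrvDl, dotrvDr) (dotrvC z u); ring.
rewrite big_split big_split /= -[in X in _ + (_ + X)]mulr_sumr cross0 mulr0 addr0.
by rewrite (sum_fset_const A (_ : R^o)).
Qed.

Lemma Delta_ge0 A : 0 <= Delta A.
Proof. by apply: sumr_ge0 => a _; rewrite exprn_ge0 ?enorm_ge0. Qed.

Lemma Delta_fset1 x : Delta [fset x] = 0.
Proof.
rewrite /Delta /centroid cardfs1 !big_seq_fset1 invr1 scale1r subrr.
by rewrite enorm_sqr -(scale0r 0) dotrvZl mul0r.
Qed.

(** Balls are convex. Here this follows from [parallel_axis]: dropping [Delta A] bounds the squared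
    distance of the centroid by the mean squared distance of the points. *)
Lemma enorm_centroid_le A c s : A != fset0 ->
  (forall a, a \in A -> enorm (a - c) <= s) -> enorm (centroid A - c) <= s.
Proof.
move=> A0 As; have [a aA] := fset0Pn _ A0.
have s0 : 0 <= s := le_trans (enorm_ge0 _) (As a aA).
rewrite -(ler_pXn2r (n := 2)) ?nnegrE ?enorm_ge0 //.
have n0 : 0 < #|` A|%:R :> R by rewrite ltr0n lt0n cardfs_eq0.
rewrite -(ler_pM2l n0) -[leLHS]add0r.
apply: le_trans (lerD (Delta_ge0 A) (lexx _)) _; rewrite -parallel_axis.
have -> : #|` A|%:R * s ^+ 2 = \sum_(a <- A) s ^+ 2.
  by rewrite (sum_fset_const A (_ : R^o)).
rewrite !(big_seq_cond xpredT); apply: ler_sum => b; rewrite andbT => bA.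
by rewrite ler_pXn2r ?nnegrE ?enorm_ge0 // As.
Qed.

Lemma sum_fsetU (V : nmodType) (F : 'rV[R]_d -> V) A B : [disjoint A & B]%fset ->
  \sum_(x <- A `|` B) F x = \sum_(x <- A) F x + \sum_(x <- B) F x.
Proof.
move=> /fdisjointP dAB; rewrite (big_fsetID _ (mem A)); congr (_ + _).
  by apply: (eq_fbigl +%R) => x; rewrite !inE; case: (x \in A); rewrite ?orbT ?andbF.
apply: (eq_fbigl +%R) => x; rewrite !inE.
by have := dAB x; case: (x \in A); case: (x \in B) => // /(_ isT).
Qed.

(** Apply [parallel_axis] to each part at the common centroid, which divides the segment between the
    two centroids in inverse proportion to the cardinalities. *)
Lemma ward_costE A B : A != fset0 -> B != fset0 -> [disjoint A & B]%fset ->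
  ward_cost A B = #|` A|%:R * #|` B|%:R / (#|` A|%:R + #|` B|%:R) *
                  enorm (centroid A - centroid B) ^+ 2.
Proof.
move=> A0 B0 dAB; set c := centroid (A `|` B).
have a0 : 0 < #|` A|%:R :> R by rewrite ltr0n lt0n cardfs_eq0.
have b0 : 0 < #|` B|%:R :> R by rewrite ltr0n lt0n cardfs_eq0.
have eU : #|` A `|` B|%:R = #|` A|%:R + #|` B|%:R :> R.
  by rewrite -natrD cardfsU (_ : A `&` B = fset0) ?cardfs0 ?subn0 //; apply/eqP.
have := sum_centroid (A `|` B); rewrite sum_fsetU // !sum_centroid eU -/c => ec.
rewrite /ward_cost.
have -> : Delta (A `|` B) = \sum_(x <- A `|` B) enorm (x - c) ^+ 2 by [].
rewrite sum_fsetU // !parallel_axis.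
have n0 : #|` A|%:R + #|` B|%:R != 0 :> R by rewrite gt_eqF ?addr_gt0.
have {ec} -> : c = (#|` A|%:R + #|` B|%:R)^-1 *:
    (#|` A|%:R *: centroid A + #|` B|%:R *: centroid B).
  by rewrite ec scalerA mulVf ?scale1r.
move: (centroid A) (centroid B) n0; clear.
move: (#|` A|%:R) (#|` B|%:R) => a b x y n0.
have -> : x - (a + b)^-1 *: (a *: x + b *: y) = (b / (a + b)) *: (x - y).
  by apply/rowP => i; rewrite !mxE; field.
have -> : y - (a + b)^-1 *: (a *: x + b *: y) = (- (a / (a + b))) *: (x - y).
  by apply/rowP => i; rewrite !mxE; field.
by rewrite !enormZ_sqr; field.
Qed.

End EuclideanNorm.

Lemma fset_min (R : realFieldType) (T : choiceType) (v : T -> R) (F : {fset T}) :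
  F != fset0 -> exists2 M, M \in F & forall A, A \in F -> v M <= v A.
Proof.
case/fset0Pn => x xF.
case: (@Order.TotalTheory.arg_minP _ _ _ [` xF] xpredT (fun y : F => v (val y)) isT).
move=> M _ minM; exists (val M); first exact: valP.
by move=> A AF; exact: (minM [` AF] isT).
Qed.

(** * Potential argument for one merge, over an abstract class relation and value *)

Section Representatives.
Variables (R : realFieldType) (T : choiceType) (r : rel T) (v : T -> R).
Hypotheses (r_sym : symmetric r) (r_trans : transitive r).

(* The members of E are charged for the remaining merges; each keeps a cheaper
   uncharged representative in the same class. *)
Definition represented (W E : {fset T}) : Prop :=
  E `<=` W /\
  forall A, A \in E -> exists S, [/\ S \in W, S \notin E, r A S & v S <= v A].

(** In the application [r] is [coclustered], [v] is [excess], [Z] is the union of the merged pair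
    and [D0] is the cost of that merge. *)
Variables (W E : {fset T}) (Z : T) (D0 : R).
Hypotheses (repE : represented W E) (ZW : Z \notin W) (D0_ge0 : 0 <= D0).
Hypothesis D0_min : forall A B, A \in W -> B \in W -> A != B -> r A B ->
  D0 <= v A + v B.

(** One charge is given up per merge, and the increase [D0] of the clustering cost is paid by the
    decrease of twice the charged value. *)
Definition merge_step X Y := exists E' : {fset T},
  [/\ represented (Z |` (W `\ X `\ Y)) E', #|` E| = #|` E'|.+1 &
      2 * \sum_(A <- E') v A + D0 <= 2 * \sum_(A <- E) v A].

(** This is all that the geometric separation contributes: a pair from two different classes can be
    merged only if one of the two is alone in its class. *)
Definition separated_pair X Y := forall X' Y', X' \in W -> Y' \in W ->
  r X X' -> X' != X -> r Y Y' -> Y' != Y -> r X Y.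

Definition additive_pair X Y := r X Y -> v Z = v X + v Y - D0 /\ r X Z.

Lemma merge_stepC X Y : merge_step X Y -> merge_step Y X.
Proof.
case=> E' [h1 h2 h3]; exists E'; split=> //.
by rewrite (_ : W `\ Y `\ X = W `\ X `\ Y) //; apply/fsetP => A; rewrite !inE andbCA.
Qed.

Lemma separated_pairC X Y : separated_pair X Y -> separated_pair Y X.
Proof. by move=> h X' Y' ? ? ? ? ? ?; rewrite r_sym; exact: (h Y' X'). Qed.

Lemma additive_pairC X Y : additive_pair X Y -> additive_pair Y X.
Proof.
move=> h; rewrite /additive_pair r_sym => rXY; have [-> rXZ] := h rXY; split.
  by rewrite (addrC (v Y)).
by apply: r_trans rXZ; rewrite r_sym.
Qed.

(** Merging [A] with its representative is a competing merge, and the representative has no larger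
    value. *)
Lemma min_le_double A : A \in E -> D0 <= 2 * v A.
Proof.
move=> AE; have [S [SW SE rAS vSA]] := repE.2 A AE.
have AS : A != S by apply: contraNneq SE => <-.
have := D0_min (fsubsetP repE.1 A AE) SW AS rAS; lra.
Qed.

Lemma merged_notin : Z \notin E.
Proof. by apply: contra ZW; exact: (fsubsetP repE.1). Qed.

Lemma neq_merged A : A \in W -> A != Z.
Proof. by apply: contraTneq => ->. Qed.

Lemma card_drop A : A \in E -> #|` E| = #|` E `\ A|.+1.
Proof. by move=> AE; rewrite (cardfsD1 A E) AE. Qed.

Lemma cost_drop M : M \in E ->
  2 * \sum_(A <- E `\ M) v A + D0 <= 2 * \sum_(A <- E) v A.
Proof. by move=> ME; rewrite (big_fsetD1 M ME) /=; have := min_le_double ME; lra. Qed.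

(** All charged members survive, but those in the class of [X] or [Y] may lose their representative.
    Uncharging the cheapest of them provides a new one and pays for the merge. *)
Lemma merge_step_outside X Y : E != fset0 -> X \in W -> Y \in W ->
  separated_pair X Y -> X \notin E -> Y \notin E -> merge_step X Y.
Proof.
move=> E0 XW YW sep XE YE; have [EW rep] := repE.
have sW A : A \in E -> A \in Z |` (W `\ X `\ Y).
  move=> AE; rewrite !inE (fsubsetP EW _ AE) andbT; apply/orP; right.
  by apply/andP; split; [apply: contraNneq YE | apply: contraNneq XE] => <-.
pose C := [fset A in E | r A X || r A Y].
have [C0|C0] := eqVneq C fset0.
  (* No representative is lost, so any charged member may be released. *)
  have [M ME] := fset0Pn _ E0; exists (E `\ M); split; [|exact: card_drop|exact: cost_drop].
  split; first by apply/fsubsetP => A; rewrite !inE => /andP[_ /sW]; rewrite !inE.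
  move=> A; rewrite !inE => /andP[AM AE]; have [S [SW SE rAS vS]] := rep A AE.
  have rn : ~~ (r A X || r A Y).
    apply/negP => h; suff : A \in C by rewrite C0 inE.
    by rewrite !inE AE.
  exists S; split=> //; last by rewrite !inE (negbTE SE) andbF.
  rewrite !inE SW andbT; apply/orP; right.
  by apply/andP; split; apply: contraNneq rn => <-; rewrite rAS ?orbT.
have [M] := fset_min v C0; rewrite !inE => /andP[ME rM] minM.
exists (E `\ M); split; [|exact: card_drop|exact: cost_drop].
split; first by apply/fsubsetP => A; rewrite !inE => /andP[_ /sW]; rewrite !inE.
move=> A; rewrite !inE => /andP[AM AE]; have [S [SW SE rAS vS]] := rep A AE.
have [rA|rn] := boolP (r A X || r A Y); last first.
  exists S; split=> //; last by rewrite !inE (negbTE SE) andbF.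
  rewrite !inE SW andbT; apply/orP; right.
  by apply/andP; split; apply: contraNneq rn => <-; rewrite rAS ?orbT.
have vMA : v M <= v A by apply: minM; rewrite !inE AE rA.
exists M; split=> //; [exact: sW | by rewrite !inE eqxx |].
have WE B : B \in E -> B \in W := fsubsetP EW B.
have nX B : B \in E -> B != X by move=> BE; apply: contraNneq XE => <-.
have nY B : B \in E -> B != Y by move=> BE; apply: contraNneq YE => <-.
(* In the mixed cases [A] and [M] are further clusters in the classes of [X] and [Y], so separation
   identifies the two classes. *)
case/orP: rA => rA; case/orP: rM => rM.
- by apply: r_trans rA _; rewrite r_sym.
- have rXY : r X Y by apply: (sep A M); rewrite ?WE ?nX ?nY // r_sym.
  by apply: r_trans rA (r_trans rXY _); rewrite r_sym.
- have rXY : r X Y by apply: (sep M A); rewrite ?WE ?nX ?nY // r_sym.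
  by apply: r_trans rA _; rewrite r_sym; exact: r_trans rM rXY.
- by apply: r_trans rA _; rewrite r_sym.
Qed.

(** [X] leaves the charged set with the merge and normally pays for it. Only charged members
    represented by [Y] need a replacement: [Z], another uncharged cluster, or as a last resort the
    cheapest charged member [M] of that class. *)
Lemma merge_step_half X Y : X \in W -> Y \in W ->
  separated_pair X Y -> additive_pair X Y -> X \in E -> Y \notin E ->
  merge_step X Y.
Proof.
move=> XW YW sep add XE YE; have [EW rep] := repE.
have WE B : B \in E -> B \in W := fsubsetP EW B.
have nY B : B \in E -> B != Y by move=> BE; apply: contraNneq YE => <-.
have sW A : A != X -> A \in E -> A \in Z |` (W `\ X `\ Y).
  by move=> AX AE; rewrite !inE AX nY // WE // orbT.
have keep S : S \in W -> S \notin E -> S != Y -> S \in Z |` (W `\ X `\ Y).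
  by move=> SW SE SY; rewrite !inE SW SY (_ : S != X) ?orbT //; apply: contraNneq SE => ->.
have subX : E `\ X `<=` Z |` (W `\ X `\ Y).
  by apply/fsubsetP => A; rewrite in_fsetD1 => /andP[]; exact: sW.
pose F := [fset A in E `\ X | r A Y].
have [F0|F0] := eqVneq F fset0.
  exists (E `\ X); split; [split=> // A|exact: card_drop|exact: cost_drop].
  rewrite in_fsetD1 => /andP[AX AE]; have [S [SW SE rAS vS]] := rep A AE.
  exists S; split=> //; last by rewrite in_fsetD1 (negbTE SE) andbF.
  apply: keep => //; apply/eqP => SY.
  by have : A \in F by [rewrite !inE AX AE -SY]; rewrite F0 inE.
have [M] := fset_min v F0; rewrite !inE => /andP[/andP[MX ME] rMY] minM.
have [RX [RXW RXE rX _]] := rep X XE.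
have rXY : r X Y.
  apply: (sep RX M) => //; [exact: WE | | by rewrite r_sym | exact: nY].
  by apply: contraNneq RXE => ->.
have [vZ rXZ] := add rXY.
have rYZ : r Y Z by apply: r_trans rXZ; rewrite r_sym.
(* If [Z] is no dearer than [M], it takes over from [Y]; otherwise the representative of [M] does,
   unless that is [Y] itself. *)
have [vZM|vMZ] := leP (v Z) (v M).
  exists (E `\ X); split; [split=> // A|exact: card_drop|exact: cost_drop].
  rewrite in_fsetD1 => /andP[AX AE]; have [S [SW SE rAS vS]] := rep A AE.
  have [SY|SY] := eqVneq S Y; last first.
    by exists S; split; rewrite ?keep // in_fsetD1 (negbTE SE) andbF.
  rewrite SY in rAS; exists Z; split; first by rewrite in_fset1U eqxx.
  - by rewrite in_fsetD1 (negbTE merged_notin) andbF.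
  - exact: r_trans rAS rYZ.
  - by apply: le_trans vZM (minM _ _); rewrite !inE AX AE.
have [SM [SMW SME rMS vSM]] := rep M ME.
have [SMY|SMY] := eqVneq SM Y; last first.
  exists (E `\ X); split; [split=> // A|exact: card_drop|exact: cost_drop].
  rewrite in_fsetD1 => /andP[AX AE]; have [S [SW SE rAS vS]] := rep A AE.
  have [SY|SY] := eqVneq S Y; last first.
    by exists S; split; rewrite ?keep // in_fsetD1 (negbTE SE) andbF.
  rewrite SY in rAS; exists SM; split; first exact: keep.
  - by rewrite in_fsetD1 (negbTE SME) andbF.
  - by apply: r_trans rAS (r_trans _ rMS); rewrite r_sym.
  - by apply: le_trans vSM (minM _ _); rewrite !inE AX AE.
(* Now [v Y <= v M < v Z]. Charge [Z] in place of [X] and [M], and let [M] represent the class. The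
   potential does not grow because [v Z = v X + v Y - D0] and [v Y <= v M]. *)
have ZEXM : Z \notin E `\ X `\ M by rewrite !inE (negbTE merged_notin) !andbF.
have MEX : M \in E `\ X by rewrite in_fsetD1 MX.
exists (Z |` (E `\ X `\ M)); split.
- split.
    apply/fsubsetP => A; rewrite in_fset1U => /orP[/eqP->|].
      by rewrite in_fset1U eqxx.
    by rewrite in_fsetD1 => /andP[_]; exact: (fsubsetP subX).
  have MW' : M \in Z |` (W `\ X `\ Y) by exact: sW.
  have MnE' : M \notin Z |` (E `\ X `\ M).
    by rewrite !inE eqxx orbF neq_merged ?WE.
  move=> A; rewrite in_fset1U => /orP[/eqP->|].
    exists M; split=> //; last exact: ltW.
    by rewrite r_sym; exact: r_trans rMY rYZ.
  rewrite 2!in_fsetD1 => /and3P[AM AX AE].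
  have [S [SW SE rAS vS]] := rep A AE.
  have [SY|SY] := eqVneq S Y; last first.
    exists S; split; rewrite ?keep // in_fset1U (negbTE (neq_merged SW)).
    by rewrite !inE (negbTE SE) !andbF.
  rewrite SY in rAS; exists M; split=> //.
    by apply: r_trans rAS _; rewrite r_sym.
  by apply: minM; rewrite !inE AX AE.
- by rewrite (card_drop XE) cardfsU1 ZEXM add1n (cardfsD1 M (E `\ X)) MEX.
- rewrite big_fsetU1 ?ZEXM //= (big_fsetD1 X XE) /= (big_fsetD1 M MEX) /= vZ.
  by move: vSM D0_ge0; rewrite SMY; lra.
Qed.

(** Two charges vanish with the merge, so one must be added: the dearer of [Z] and the
    representative [RX] of [X] becomes charged, and the cheaper one represents it. *)
Lemma merge_step_inside X Y : X \in W -> Y \in W -> X != Y ->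
  separated_pair X Y -> additive_pair X Y -> X \in E -> Y \in E ->
  v X <= v Y -> merge_step X Y.
Proof.
move=> XW YW XY sep add XE YE vXY; have [EW rep] := repE.
have WE B : B \in E -> B \in W := fsubsetP EW B.
have [RX [RXW RXE rX vRX]] := rep X XE.
have [RY [RYW RYE rY _]] := rep Y YE.
have neqE A B : A \in E -> B \notin E -> B != A by move=> AE; apply: contraNneq => ->.
have rXY : r X Y by apply: (sep RX RY); rewrite ?neqE.
have [vZ rXZ] := add rXY.
have keep S : S \in W -> S \notin E -> S \in Z |` (W `\ X `\ Y).
  by move=> SW SE; rewrite !inE SW !neqE // orbT.
have subXY : E `\ X `\ Y `<=` Z |` (W `\ X `\ Y).
  apply/fsubsetP => A; rewrite 2!in_fsetD1 => /and3P[AY AX AE].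
  by rewrite !inE AY AX WE // orbT.
have YEX : Y \in E `\ X by rewrite in_fsetD1 eq_sym XY.
have cardE B : B \notin E `\ X `\ Y -> #|` E| = #|` B |` (E `\ X `\ Y)|.+1.
  by move=> nB; rewrite (card_drop XE) cardfsU1 nB add1n (cardfsD1 Y (E `\ X)) YEX.
have [vRZ|vZR] := leP (v RX) (v Z).
  have ZEXY : Z \notin E `\ X `\ Y by rewrite !inE (negbTE merged_notin) !andbF.
  exists (Z |` (E `\ X `\ Y)); split; [|exact: cardE|].
    split.
      by apply/fsubsetP => A; rewrite in_fset1U => /orP[/eqP->|/(fsubsetP subXY)//];
         rewrite in_fset1U eqxx.
    have nE' S : S \in W -> S \notin E -> S \notin Z |` (E `\ X `\ Y).
      by move=> SW SE; rewrite in_fset1U (negbTE (neq_merged SW)) !inE (negbTE SE) !andbF.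
    move=> A; rewrite in_fset1U => /orP[/eqP->|].
      exists RX; split; rewrite ?keep ?nE' //.
      by apply: r_trans rX; rewrite r_sym.
    rewrite 2!in_fsetD1 => /and3P[AY AX AE].
    by have [S [SW SE rAS vS]] := rep A AE; exists S; split; rewrite ?keep ?nE'.
  rewrite big_fsetU1 ?ZEXY //= (big_fsetD1 X XE) /= (big_fsetD1 Y YEX) /= vZ.
  by have := D0_ge0; lra.
(* Charging [RX] costs at most the released [v X], while twice [v Y] covers [D0]. Members that
   relied on [RX] switch to the cheaper [Z]. *)
have REXY : RX \notin E `\ X `\ Y by rewrite !inE (negbTE RXE) !andbF.
exists (RX |` (E `\ X `\ Y)); split; [|exact: cardE|].
  split.
    by apply/fsubsetP => A; rewrite in_fset1U => /orP[/eqP->|/(fsubsetP subXY)//];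
       exact: keep.
  have ZW' : Z \in Z |` (W `\ X `\ Y) by rewrite in_fset1U eqxx.
  have merged_notin' : Z \notin RX |` (E `\ X `\ Y).
    by rewrite !inE (negbTE merged_notin) !andbF orbF eq_sym neq_merged.
  move=> A; rewrite in_fset1U => /orP[/eqP->|].
    by exists Z; split=> //; [apply: r_trans rXZ; rewrite r_sym | exact: ltW].
  rewrite 2!in_fsetD1 => /and3P[AY AX AE].
  have [S [SW SE rAS vS]] := rep A AE.
  have [SR|SR] := eqVneq S RX; last first.
    by exists S; split; rewrite ?keep // !inE (negbTE SE) !andbF orbF.
  rewrite SR in rAS vS; exists Z; split=> //; last by lra.
  by apply: r_trans rAS (r_trans _ rXZ); rewrite r_sym.
rewrite big_fsetU1 ?REXY //= (big_fsetD1 X XE) /= (big_fsetD1 Y YEX) /=.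
by have := min_le_double YE; lra.
Qed.

Lemma merge_stepP X Y : E != fset0 -> X \in W -> Y \in W -> X != Y ->
  separated_pair X Y -> additive_pair X Y -> merge_step X Y.
Proof.
move=> E0 XW YW XY sep add.
have [XE|XE] := boolP (X \in E); have [YE|YE] := boolP (Y \in E).
- have [vXY|/ltW vYX] := leP (v X) (v Y); first exact: merge_step_inside.
  apply/merge_stepC/merge_step_inside => //; first by rewrite eq_sym.
    exact: separated_pairC.
  exact: additive_pairC.
- exact: merge_step_half.
- apply/merge_stepC/merge_step_half => //; first exact: separated_pairC.
  exact: additive_pairC.
- exact: merge_step_outside.
Qed.

End Representatives.

(** * Disjoint families of finite sets *)

Section Partitions.
Variables (T : choiceType).
Implicit Types (W : {fset {fset T}}) (A B : {fset T}).

Lemma trivIfset_eq W A B x :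
  trivIfset W -> A \in W -> B \in W -> x \in A -> x \in B -> A = B.
Proof.
move=> /trivIfsetP tW AW BW xA xB; apply/eqP; apply: contraT => AB.
by have /fdisjointP/(_ x xA) := tW A B AW BW AB; rewrite xB.
Qed.

Lemma mem_fcover W A x : A \in W -> x \in A -> x \in fcover W.
Proof. by move=> AW xA; apply/bigfcupP; exists A; rewrite ?AW. Qed.

End Partitions.

(** * Effect of a merge on partition, cardinality and cost *)

Section WardStep.
Variables (R : realType) (d : nat).
Implicit Types (P A B : {fset 'rV[R]_d}) (W O : {fset {fset 'rV[R]_d}}).

Lemma ward_costC A B : ward_cost A B = ward_cost B A.
Proof. by rewrite /ward_cost fsetUC addrAC. Qed.

Lemma ward_cost_ge0 A B : A != fset0 -> B != fset0 -> [disjoint A & B]%fset ->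
  0 <= ward_cost A B.
Proof.
move=> A0 B0 dAB; rewrite ward_costE // mulr_ge0 ?exprn_ge0 ?enorm_ge0 //.
by rewrite divr_ge0 ?mulr_ge0 ?addr_ge0 ?ler0n.
Qed.

Lemma cluster_neq0 P W A : is_partition P W -> A \in W -> A != fset0.
Proof. by case=> W0 _ _; apply: contraTneq => ->. Qed.

Lemma clusters_disjoint P W A B : is_partition P W -> A \in W -> B \in W ->
  A != B -> [disjoint A & B]%fset.
Proof. by case=> _ /trivIfsetP tW _; exact: tW. Qed.

Section Merge.
Variables (P A B : {fset 'rV[R]_d}) (W : {fset {fset 'rV[R]_d}}).
Hypotheses (partW : is_partition P W) (AW : A \in W) (BW : B \in W) (AB : A != B).

(** A cluster equal to the union would meet both [A] and [B], hence coincide with both. *)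
Lemma fsetU_notin : A `|` B \notin W.
Proof.
have [_ tW _] := partW; have [a aA] := fset0Pn _ (cluster_neq0 partW AW).
have [b bB] := fset0Pn _ (cluster_neq0 partW BW).
apply: contra AB => ABW.
rewrite (trivIfset_eq tW AW ABW aA) ?inE ?aA //.
by rewrite {2}(trivIfset_eq tW BW ABW bB) ?inE ?bB ?orbT.
Qed.

Lemma fsetU_notinD : A `|` B \notin W `\ A `\ B.
Proof. by rewrite !inE (negbTE fsetU_notin) !andbF. Qed.

Lemma mem_fsetD1_merge : B \in W `\ A. Proof. by rewrite in_fsetD1 eq_sym AB. Qed.

Lemma merge_partition : is_partition P ((A `|` B) |` (W `\ A `\ B)).
Proof.
have [W0 tW cW] := partW; split.
- rewrite !inE (negbTE W0) !andbF orbF eq_sym fsetU_eq0 negb_and.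
  by rewrite (cluster_neq0 partW AW).
- have dU C : C \in W `\ A `\ B -> [disjoint A `|` B & C]%fset.
    rewrite 2!in_fsetD1 => /and3P[CB CA CW]; rewrite fdisjointUX.
    by rewrite !(clusters_disjoint partW) // eq_sym.
  apply/trivIfsetP => C D; rewrite 2!in_fset1U.
  case/orP=> [/eqP->|CW] /orP[/eqP->|DW]; rewrite ?eqxx // => CD.
  + exact: dU.
  + by rewrite fdisjoint_sym dU.
  + move: CW DW; rewrite !inE => /and3P[_ _ CW] /and3P[_ _ DW].
    exact: (clusters_disjoint partW).
- rewrite -cW; apply/fsetP => x; apply/bigfcupP/bigfcupP => -[C].
    rewrite andbT in_fset1U => /orP[/eqP->|]; last first.
      by rewrite 2!in_fsetD1 => /and3P[_ _ CW] xC; exists C; rewrite ?CW.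
    by rewrite in_fsetU => /orP[] xAB; [exists A | exists B]; rewrite ?AW ?BW.
  rewrite andbT => CW xC; have [CA|CA] := eqVneq C A.
    by exists (A `|` B); rewrite ?in_fset1U ?eqxx // in_fsetU -CA xC.
  have [CB|CB] := eqVneq C B.
    by exists (A `|` B); rewrite ?in_fset1U ?eqxx // in_fsetU -CB xC orbT.
  by exists C => //; rewrite !inE CA CB CW orbT.
Qed.

Lemma merge_card : #|` W| = #|` (A `|` B) |` (W `\ A `\ B)|.+1.
Proof.
rewrite cardfsU1 fsetU_notinD add1n (cardfsD1 A W) AW.
by rewrite (cardfsD1 B (W `\ A)) mem_fsetD1_merge.
Qed.

Lemma merge_cost :
  kmeans_cost ((A `|` B) |` (W `\ A `\ B)) = kmeans_cost W + ward_cost A B.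
Proof.
rewrite /kmeans_cost big_fsetU1 ?fsetU_notinD //= (big_fsetD1 A AW) /=.
by rewrite (big_fsetD1 B mem_fsetD1_merge) /= /ward_cost; ring.
Qed.

End Merge.

Lemma singletons_partition P : is_partition P (singletons P).
Proof.
split.
- apply/imfsetP => -[p _ /fsetP/(_ p)].
  by rewrite !inE eqxx.
- apply/trivIfsetP => _ _ /imfsetP[p _ ->] /imfsetP[q _ ->] pq.
  by rewrite fdisjoint1X inE; apply: contraNneq pq => ->.
- apply/fsetP => x; apply/bigfcupP/idP => [[_ /andP[/imfsetP[p pP ->] _]]|xP].
    by rewrite inE => /eqP->.
  by exists [fset x]; rewrite ?inE // andbT; apply/imfsetP; exists x.
Qed.

Lemma card_singletons P : #|` singletons P| = #|` P|.
Proof. by rewrite card_imfset //; exact: fset1_inj. Qed.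

Lemma kmeans_cost_singletons P : kmeans_cost (singletons P) = 0.
Proof.
rewrite /kmeans_cost big_seq big1 // => _ /imfsetP[p _ ->]; exact: Delta_fset1.
Qed.

End WardStep.

(** * Excess over the optimal centers and the invariant at the start *)

Section Excess.
Variables (R : realType) (d : nat) (P : {fset 'rV[R]_d}) (O : {fset {fset 'rV[R]_d}}).
Hypothesis partO : is_partition P O.
Implicit Types (A B Q : {fset 'rV[R]_d}) (W : {fset {fset 'rV[R]_d}}).

(* At most one summand is nonzero, since O is a partition. *)
Definition sqr_dist_center (x : 'rV[R]_d) : R :=
  \sum_(Q <- O) if x \in Q then enorm (x - centroid Q) ^+ 2 else 0.

(* Cost of A when its points are served by their optimal centers, minus the cost
   of A with its own centroid. *)
Definition excess A : R := \sum_(a <- A) sqr_dist_center a - Delta A.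

(** Nonemptiness makes the relation transitive, since a nonempty middle set determines [Q]. A set
    straddling several members of [O] is related to nothing, not even itself. *)
Definition coclustered : rel {fset 'rV[R]_d} := fun A B =>
  [&& A != fset0, B != fset0 & has (fun Q => (A `<=` Q) && (B `<=` Q)) O].

Lemma coclusteredP A B : reflect
  [/\ A != fset0, B != fset0 & exists Q, [/\ Q \in O, A `<=` Q & B `<=` Q]]
  (coclustered A B).
Proof.
apply: (iffP and3P) => -[A0 B0] h; split=> //.
  by have [Q QO /andP[AQ BQ]] := hasP h; exists Q.
by have [Q [QO AQ BQ]] := h; apply/hasP; exists Q; rewrite ?AQ ?BQ.
Qed.

Lemma coclustered_sym : symmetric coclustered.
Proof.
by move=> A B; apply/coclusteredP/coclusteredP => -[A0 B0 [Q [QO AQ BQ]]];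
  split=> //; exists Q.
Qed.

Lemma coclustered_trans : transitive coclustered.
Proof.
have [_ tO _] := partO.
move=> B A C /coclusteredP[A0 B0 [Q [QO AQ BQ]]] /coclusteredP[_ C0 [S [SO BS CS]]].
apply/coclusteredP; split=> //; exists Q; split=> //.
have [b bB] := fset0Pn _ B0.
by rewrite (trivIfset_eq tO QO SO (fsubsetP BQ b bB) (fsubsetP BS b bB)).
Qed.

Lemma sqr_dist_centerE Q x : Q \in O -> x \in Q ->
  sqr_dist_center x = enorm (x - centroid Q) ^+ 2.
Proof.
move=> QO xQ; have [_ tO _] := partO.
rewrite /sqr_dist_center (big_fsetD1 Q QO) /= xQ big_seq big1 ?addr0 // => S.
rewrite in_fsetD1 => /andP[SQ SO]; case: ifPn => // xS.
by rewrite (trivIfset_eq tO SO QO xS xQ) eqxx in SQ.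
Qed.

Lemma excessE A Q : Q \in O -> A `<=` Q ->
  excess A = #|` A|%:R * enorm (centroid A - centroid Q) ^+ 2.
Proof.
move=> QO AQ; have eA : \sum_(a <- A) sqr_dist_center a =
    \sum_(a <- A) enorm (a - centroid Q) ^+ 2.
  by apply: eq_big_seq => a aA; apply: sqr_dist_centerE QO (fsubsetP AQ a aA).
by rewrite /excess eA parallel_axis; ring.
Qed.

Lemma excess_ge0 A Q : Q \in O -> A `<=` Q -> 0 <= excess A.
Proof.
by move=> QO AQ; rewrite (excessE QO AQ) mulr_ge0 ?ler0n ?exprn_ge0 ?enorm_ge0.
Qed.

Lemma excessU A B : [disjoint A & B]%fset ->
  excess (A `|` B) = excess A + excess B - ward_cost A B.
Proof. by move=> dAB; rewrite /excess sum_fsetU // /ward_cost; ring. Qed.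

(** The union still lies in one optimal cluster, so its excess [excess A + excess B - ward_cost A B]
    is nonnegative. *)
Lemma ward_cost_le_excess A B : [disjoint A & B]%fset -> coclustered A B ->
  ward_cost A B <= excess A + excess B.
Proof.
move=> dAB /coclusteredP[_ _ [Q [QO AQ BQ]]].
have : 0 <= excess (A `|` B) by apply: excess_ge0 QO _; rewrite fsubUset AQ.
by rewrite excessU // subr_ge0.
Qed.

Lemma coclusteredU A B : coclustered A B -> coclustered A (A `|` B).
Proof.
move=> /coclusteredP[A0 B0 [Q [QO AQ BQ]]]; apply/coclusteredP; split=> //.
  by rewrite fsetU_eq0 negb_and A0.
by exists Q; split=> //; rewrite fsubUset AQ.
Qed.

Lemma sum_sqr_dist_center : \sum_(p <- P) sqr_dist_center p = kmeans_cost O.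
Proof.
have [_ tO <-] := partO; rewrite big_trivIfset //.
apply: eq_big_seq => Q QO; apply: eq_big_seq => x xQ.
exact: sqr_dist_centerE.
Qed.

(** The cardinality equation makes [E] as large as the number of merges still to come; with [E]
    empty the inequality is the approximation bound. *)
Definition cost_invariant W := exists E,
  [/\ represented coclustered excess W E, (#|` E| + #|` O|)%N = #|` W| &
      kmeans_cost W + 2 * \sum_(A <- E) excess A <= 2 * kmeans_cost O].

Lemma excess_fset1 p : excess [fset p] = sqr_dist_center p.
Proof. by rewrite /excess big_seq_fset1 Delta_fset1 subr0. Qed.

(** In each optimal cluster the point closest to its center stays uncharged and represents the
    others. *)
Lemma cost_invariant_singletons : cost_invariant (singletons P).
Proof.
have [O0 tO cO] := partO.
have inP Q x : Q \in O -> x \in Q -> x \in P by rewrite -cO; exact: mem_fcover.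
(* Taking the head of the list of minimizers makes the choice a function of [Q]; the default is
   never reached for [Q] in [O], as a minimizer exists. *)
pose closest Q := head 0
  [seq q <- Q | all (fun x => sqr_dist_center q <= sqr_dist_center x) Q].
have closestP Q : Q \in O -> closest Q \in Q /\
    forall x, x \in Q -> sqr_dist_center (closest Q) <= sqr_dist_center x.
  move=> QO; have [q qQ minq] := fset_min sqr_dist_center (cluster_neq0 partO QO).
  suff : closest Q \in
      [seq q <- Q | all (fun x => sqr_dist_center q <= sqr_dist_center x) Q].
    by rewrite mem_filter => /andP[/allP h cQ]; split.
  rewrite /closest; set s := filter _ _.
  have : q \in s by rewrite mem_filter qQ andbT; apply/allP.
  by case: s => // y s _; rewrite mem_head.
pose reps := [fset [fset closest Q] | Q in O].
have sub_reps : reps `<=` singletons P.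
  apply/fsubsetP => _ /imfsetP[Q QO ->]; apply/imfsetP; exists (closest Q) => //.
  by apply: (inP Q) => //; case: (closestP Q QO).
exists (singletons P `\` reps); split.
- split; first exact: fsubsetDl.
  move=> A; rewrite in_fsetD => /andP[_ /imfsetP[p pP ->]].
  move: (pP); rewrite -{1}cO => /bigfcupP[Q]; rewrite andbT => QO pQ.
  have [cQ minQ] := closestP Q QO.
  have cR : [fset closest Q] \in reps by apply/imfsetP; exists Q.
  exists [fset closest Q]; split.
  + exact: (fsubsetP sub_reps).
  + by rewrite in_fsetD cR.
  + apply/coclusteredP; split; try by apply/fset0Pn; eexists; exact: fset11.
    by exists Q; rewrite !fsub1set.
  + by rewrite !excess_fset1 minQ.
- rewrite -[in RHS](cardfsID reps (singletons P)) addnC; congr (_ + _)%N.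
  rewrite (fsetIidPr sub_reps) card_in_imfset //= => Q S QO SO /fset1_inj eQS.
  have [cQ _] := closestP Q QO; have [cS _] := closestP S SO.
  by apply: (trivIfset_eq tO QO SO cQ); rewrite eQS.
(* Singletons cost nothing, and their total excess is exactly [kmeans_cost O]. *)
- rewrite kmeans_cost_singletons add0r ler_pM2l ?ltr0n // -sum_sqr_dist_center.
  have -> : \sum_(p <- P) sqr_dist_center p = \sum_(A <- singletons P) excess A.
    rewrite big_imfset /=; last by move=> p q _ _ /fset1_inj.
    by apply: eq_bigr => p _; rewrite excess_fset1.
  rewrite [leRHS](big_fsetID _ (mem reps)) /= addrC.
  rewrite (eq_fbigl +%R (B := [fset A in singletons P | A \notin reps])); last first.
    by move=> A; rewrite !inE andbC.
  rewrite lerDl big_seq sumr_ge0 // => A; rewrite !inE => /andP[/imfsetP[p pP ->] _].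
  by rewrite excess_fset1 sumr_ge0 // => Q _; case: ifP => // _; rewrite exprn_ge0 ?enorm_ge0.
Qed.

End Excess.

(** * Consequences of center separation and the run of Ward's method *)

Section Separation.
Variables (R : realType) (d : nat) (P : {fset 'rV[R]_d}) (O : {fset {fset 'rV[R]_d}}).
Variable eps : R.
Hypotheses (eps_gt0 : 0 < eps) (partO : is_partition P O).
Implicit Types (A B Q S X Y : {fset 'rV[R]_d}) (W : {fset {fset 'rV[R]_d}}).

Let delta : R := 2 + 2 * Num.sqrt 2 + eps.

Hypothesis sepO : forall A B, A \in O -> B \in O -> B != A ->
  forall x, x \in A -> delta * enorm (x - centroid A) <= enorm (centroid A - centroid B).

Lemma delta_gt2 : 2 < delta.
Proof. by have := sqrtr_ge0 (2 : R); have := eps_gt0; rewrite /delta; lra. Qed.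

(** The constant is chosen for this: [delta - 2] exceeds [2 * Num.sqrt 2]. *)
Lemma delta_sqr_gt8 : 8 < (delta - 2) ^+ 2.
Proof.
have := sqrtr_ge0 (2 : R); have := sqr_sqrtr (ler0n R 2); have := eps_gt0.
by rewrite /delta; nra.
Qed.

Lemma delta_centroid_le Q S X : Q \in O -> S \in O -> S != Q ->
  X != fset0 -> X `<=` Q ->
  delta * enorm (centroid X - centroid Q) <= enorm (centroid Q - centroid S).
Proof.
move=> QO SO SQ X0 XQ; have d2 := delta_gt2.
have d0 : 0 < delta by lra.
rewrite mulrC -ler_pdivlMr //; apply: enorm_centroid_le => // x xX.
by rewrite ler_pdivlMr // mulrC sepO // (fsubsetP XQ).
Qed.

(** With sizes a, b, c of [X], [X'], [Y] and a <= c, the factor ab/(a+b) is at most a and ac/(a+c)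
    is at least a/2. It thus suffices that the squared centroid distance to [Y] is more than twice
    that to [X']. *)
Lemma ward_cost_lt_separated Q S X X' Y : Q \in O -> S \in O -> S != Q ->
  X != fset0 -> X' != fset0 -> Y != fset0 -> X `<=` Q -> X' `<=` Q -> Y `<=` S ->
  [disjoint X & X']%fset -> (#|` X| <= #|` Y|)%N -> ward_cost X X' < ward_cost X Y.
Proof.
move=> QO SO SQ X0 X'0 Y0 XQ X'Q YS dXX' leXY.
have dQS := clusters_disjoint partO QO SO; rewrite eq_sym in dQS.
have dXY : [disjoint X & Y]%fset.
  by apply: fdisjointWl XQ (fdisjointWr YS (dQS SQ)).
rewrite !ward_costE //.
have QS : Q != S by rewrite eq_sym.
have hX := delta_centroid_le QO SO SQ X0 XQ.
have hX' := delta_centroid_le QO SO SQ X'0 X'Q.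
have hY := delta_centroid_le SO QO QS Y0 YS.
(* Coinciding centers would collapse [Q] to a single point, leaving no room for the disjoint [X] and
   [X']. *)
have L0 : 0 < enorm (centroid Q - centroid S).
  rewrite lt0r enorm_ge0 andbT; apply: contraTneq dXX' => L0.
  have eqc x : x \in Q -> x = centroid Q.
    move=> xQ; apply/eqP; rewrite -subr_eq0; apply/eqP/enorm0_eq0.
    have := sepO QO SO SQ xQ; have := enorm_ge0 (x - centroid Q).
    by have := delta_gt2; rewrite L0; nra.
  have [x xX] := fset0Pn _ X0; have [y yX'] := fset0Pn _ X'0.
  apply/negP => /fdisjointP/(_ x xX); rewrite (eqc x) ?(fsubsetP XQ) //.
  by rewrite -(eqc y) ?(fsubsetP X'Q) // yX'.
have hu : enorm (centroid X - centroid X') <=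
    enorm (centroid X - centroid Q) + enorm (centroid X' - centroid Q).
  rewrite (enormB (centroid X')); apply: le_trans (enormD _ _).
  by rewrite addrA subrK.
have hw : enorm (centroid Q - centroid S) <= enorm (centroid X - centroid Q) +
    enorm (centroid X - centroid Y) + enorm (centroid Y - centroid S).
  rewrite (enormB (centroid X)); apply: le_trans (lerD (enormD _ _) (lexx _)).
  by apply: le_trans (enormD _ _); rewrite !addrA !subrK.
rewrite (enormB (centroid S)) in hY.
have u0 := enorm_ge0 (centroid X - centroid X').
have w0 := enorm_ge0 (centroid X - centroid Y).
have a0 : 0 < #|` X|%:R :> R by rewrite ltr0n cardfs_gt0.
have b0 : 0 < #|` X'|%:R :> R by rewrite ltr0n cardfs_gt0.
have ac : #|` X|%:R <= #|` Y|%:R :> R by rewrite ler_nat.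
move: hX hX' hY L0 hu hw u0 w0 a0 b0 ac delta_gt2 delta_sqr_gt8; clear.
set L := enorm (centroid Q - _).
set p := enorm (centroid X - centroid Q); set p' := enorm (centroid X' - centroid Q).
set q := enorm (centroid Y - _); set u := enorm (centroid X - centroid X').
set w := enorm (centroid X - centroid Y).
move: (#|` X|%:R) (#|` X'|%:R) (#|` Y|%:R) L p p' q u w => a b c L p p' q u w.
move: delta => D hp hp' hq L0 hu hw u0 w0 a0 b0 ac D2 D8.
(* Each of [p], [p'], [q] is at most [L / D], so the triangle inequalities bound [u] above and [w]
   below in terms of [L]. *)
have hDu : D * u <= 2 * L by nra.
have hDw : (D - 2) * L <= D * w by nra.
have hDu2 : (D * u) ^+ 2 <= 4 * L ^+ 2.
  have -> : 4 * L ^+ 2 = (2 * L) ^+ 2 by ring.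
  by rewrite ler_pXn2r ?nnegrE //; nra.
have hDw2 : ((D - 2) * L) ^+ 2 <= (D * w) ^+ 2.
  by rewrite ler_pXn2r ?nnegrE //; nra.
have L2 : 0 < L ^+ 2 by rewrite exprn_gt0.
have uw : 2 * u ^+ 2 < w ^+ 2.
  have D0 : 0 < D ^+ 2 by rewrite exprn_gt0 //; lra.
  rewrite -(ltr_pM2l D0); rewrite !exprMn in hDu2 hDw2.
  have : 8 * L ^+ 2 < (D - 2) ^+ 2 * L ^+ 2 by rewrite ltr_pM2r.
  by lra.
have c0 : 0 < c := lt_le_trans a0 ac.
apply: (@le_lt_trans _ _ (a * u ^+ 2)).
  rewrite ler_wpM2r ?exprn_ge0 // ler_pdivrMr ?addr_gt0 // ler_pM2l //; lra.
apply: (@lt_le_trans _ _ (a / 2 * w ^+ 2)); first by nra.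
rewrite ler_wpM2r ?exprn_ge0 // ler_pdivrMr // mulrAC ler_pdivlMr ?addr_gt0 //.
by nra.
Qed.

(** Otherwise merging the smaller of [X] and [Y] with its companion in the same optimal cluster
    would be strictly cheaper, against minimality. *)
Lemma separated_min_pair W X Y : is_partition P W -> X \in W -> Y \in W ->
  (forall A B, A \in W -> B \in W -> A != B -> ward_cost X Y <= ward_cost A B) ->
  separated_pair (coclustered O) W X Y.
Proof.
move=> partW XW YW minXY X' Y' X'W Y'W /coclusteredP[X0 X'0 [Q [QO XQ X'Q]]] X'X.
move=> /coclusteredP[Y0 Y'0 [S [SO YS Y'S]]] Y'Y.
apply/coclusteredP; split=> //.
have [SQ|SQ] := eqVneq S Q; first by exists Q; rewrite XQ -SQ.
rewrite eq_sym in X'X; rewrite eq_sym in Y'Y.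
have [leXY|/ltnW leYX] := leqP #|` X| #|` Y|.
  have /(ward_cost_lt_separated QO SO SQ X0 X'0 Y0 XQ X'Q YS) :=
    clusters_disjoint partW XW X'W X'X.
  by move=> /(_ leXY); rewrite ltNge minXY.
have QS : Q != S by rewrite eq_sym.
have /(ward_cost_lt_separated SO QO QS Y0 Y'0 X0 YS Y'S XQ) :=
  clusters_disjoint partW YW Y'W Y'Y.
by move=> /(_ leYX); rewrite [ward_cost Y X]ward_costC ltNge minXY.
Qed.

Lemma ward_step_invariant W W' : is_partition P W -> cost_invariant O W ->
  (#|` O| < #|` W|)%N -> ward_step W W' ->
  [/\ is_partition P W', cost_invariant O W' & #|` W| = #|` W'|.+1].
Proof.
move=> partW [E [repE cardE costE]] ltOW [X [Y [[XW YW XY] minXY ->]]].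
have dXY := clusters_disjoint partW XW YW XY.
have cardW := merge_card partW XW YW XY.
split=> //; first exact: merge_partition.
have E0 : E != fset0 by rewrite -cardfs_gt0 -(ltn_add2r #|` O|) add0n cardE.
have [|||||E' [repE' cardE' costE']] := @merge_stepP _ _ (coclustered O) (excess O)
    (@coclustered_sym _ _ O) (coclustered_trans partO) W E (X `|` Y) (ward_cost X Y)
    repE _ _ _ X Y E0 XW YW XY _ _.
- exact: (fsetU_notin partW).
- exact: ward_cost_ge0 (cluster_neq0 partW XW) (cluster_neq0 partW YW) dXY.
- move=> A B AW BW AB rAB; apply: le_trans (minXY A B AW BW AB) _.
  exact: (ward_cost_le_excess partO) (clusters_disjoint partW AW BW AB) rAB.
- exact: separated_min_pair.
- by move=> rXY; split; [exact: excessU | exact: coclusteredU].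
exists E'; split=> //.
  by apply/eqP; rewrite -eqSS -cardW -cardE cardE'.
by rewrite (merge_cost partW) //; lra.
Qed.

Lemma ward_run_invariant n W : ward_run P n W -> (n + #|` O| <= #|` P|)%N ->
  [/\ is_partition P W, cost_invariant O W & (n + #|` W|)%N = #|` P|].
Proof.
elim=> [_|m {}W W' _ IH stepW lemP].
  by rewrite card_singletons; split=> //;
    [exact: singletons_partition | exact: cost_invariant_singletons].
have [partW invW cardW] := IH (ltnW lemP).
have ltOW : (#|` O| < #|` W|)%N by rewrite -(ltn_add2l m) cardW.
have [partW' invW' cardW'] := ward_step_invariant partW invW ltOW stepW.
by split=> //; rewrite addSnnS -cardW'.
Qed.

Lemma ward_run_cost W : (#|` O| <= #|` P|)%N -> ward_run P (#|` P| - #|` O|) W ->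
  kmeans_cost W <= 2 * kmeans_cost O.
Proof.
move=> leOP /ward_run_invariant; rewrite subnK // => /(_ (leqnn _)).
case=> _ [E [_ cardE costE]] cardW.
have E0 : E = fset0.
  apply: cardfs0_eq; apply/eqP; rewrite -(eqn_add2r #|` O|) cardE add0n.
  by rewrite -(eqn_add2l (#|` P| - #|` O|)) cardW subnK.
by move: costE; rewrite E0 big_seq_fset0 mulr0 addr0.
Qed.

End Separation.

Lemma enorm_le_radius (R : realType) (d : nat) (Q : {fset 'rV[R]_d}) x :
  x \in Q -> enorm (x - centroid Q) <= radius Q.
Proof.
move=> xQ.
exact: (@le_bigmax_seq _ R _ (enum_fset Q) 0 x xpredT
          (fun y => enorm (y - centroid Q)) xQ isT).
Qed.

(* Passing to points of the other cluster costs at most 1 in the constant, by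
   the triangle inequality. *)
Lemma center_proximity_separated (R : realType) (d : nat) (alpha : R)
    (O : {fset {fset 'rV[R]_d}}) :
  (forall A B, A \in O -> B \in O -> A != B -> forall x, x \in A ->
     alpha * enorm (x - centroid A) <= enorm (x - centroid B)) ->
  forall A B, A \in O -> B \in O -> B != A -> forall x, x \in A ->
    (alpha - 1) * enorm (x - centroid A) <= enorm (centroid A - centroid B).
Proof.
move=> prox A B AO BO BA x xA; rewrite eq_sym in BA.
rewrite mulrBl mul1r lerBlDl; apply: le_trans (prox A B AO BO BA x xA) _.
by apply: le_trans (enormD _ _); rewrite addrA subrK.
Qed.

Theorem theorem20 (R : realType) (d k : nat) (eps : R) (P : {fset 'rV[R]_d})
    (eps_gt0 : 0 < eps) (leqkP : (k <= #|` P|)%N)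
    (separated :
      weak_center_separation k P (2 + 2 * Num.sqrt 2 + eps) \/
      center_proximity k P (3 + 2 * Num.sqrt 2 + eps)) :
  forall W : {fset {fset 'rV[R]_d}},
    ward_clustering k P W -> kmeans_cost W <= 2 * opt k P.
Proof.
move=> W; case: separated => -[O [partO cardO <-] sepO]; rewrite /ward_clustering -cardO;
  rewrite -cardO in leqkP; apply: (ward_run_cost eps_gt0 partO) => // A B AO BO BA x xA.
  (* Weak separation: the radius dominates the distance of each point to its center. *)
  apply: le_trans (sepO A B AO BO BA); rewrite ler_wpM2l ?enorm_le_radius //.
  by have := sqrtr_ge0 (2 : R); lra.
(* Center proximity: the loss of 1 leaves the same constant as in the first case. *)
have := center_proximity_separated sepO AO BO BA xA.
by rewrite (_ : 3 + 2 * Num.sqrt 2 + eps - 1 = 2 + 2 * Num.sqrt 2 + eps) //; ring.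
Qed.
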